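(* Let $\mu$ be a directed distance on $S$ having an oriented-tree realization $(\Gamma,\alpha;\{F_s\}_{s\in S})$, and let $(G,S,c)$ be an inner Eulerian network such that the Eulerian condition is fulfilled by each terminal $s$ for which $F_s$ is neither a single node nor a directed path. Then \[\mathrm{MFP}^*(\mu;G,S,c)=\mathrm{IMFP}^*(\mu;G,S,c)=\min\Big\{\sum_{xy\in EG}c(xy)D_{\Gamma,\alpha}(\rho(x),\rho(y)) : \rho:VG\to V\Gamma,\ \rho(s)\in VF_s\ (s\in S)\Big\}\] \[=\sum_{e\in E\Gamma}\alpha(e)\min\{c(\partial X): A_e\subseteq X\subseteq VG\setminus B_e\},\] where $(A_e,B_e)$ is the partial cut on $S$ determined by deletion of the edge $e$ of $\Gamma$.
   Context: A network $(G,S,c)$: finite digraph $G=(VG,EG)$, terminals $S\subseteq VG$, capacity $c:EG\to\mathbb Z_+$. A multiflow is a set $\mathcal P$ of directed paths joining distinct terminals with $\lambda:\mathcal P\to\mathbb R_+$, $\sum_{P\ni e}\lambda(P)\le c(e)$; integral if $\lambda$ integer-valued. A directed distance is $\mu:S\times S\to\mathbb R_+$ with zero diagonal. $\mathrm{MFP}^*(\mu;G,S,c)$ (resp. $\mathrm{IMFP}^*$) is the maximum of $\sum_P\lambda(P)\mu(s_P,t_P)$ ($s_P,t_P$ start and end of $P$) over all (resp. all integral) multiflows. A node fulfills the Eulerian condition if its outgoing capacity equals its incoming capacity; the network is inner Eulerian if every non-terminal node does. For $X\subseteq VG$, $\partial X$ is the set of edges leaving $X$ and $c(\partial X)$ its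 total capacity. An oriented tree $\Gamma$ is a digraph whose underlying undirected graph is a tree; a subtree is a subgraph whose underlying undirected graph is a tree; a directed path subtree is one that is a directed path. For $\alpha:E\Gamma\to\mathbb R_+$ and nodes $u,v$, $D_{\Gamma,\alpha}(u,v)$ is the sum of $\alpha(e)$ over edges $e=pq$ that the unique walk from $u$ to $v$ traverses in the order $u\to p\to q\to v$; for subtrees $F,F'$, $D_{\Gamma,\alpha}(F,F')=\min\{D_{\Gamma,\alpha}(u,v):u\in VF,v\in VF'\}$. An oriented-tree realization of $\mu$ is $(\Gamma,\alpha;\{F_s\}_{s\in S})$ with $F_s$ subtrees of $\Gamma$ and $\mu(s,t)=D_{\Gamma,\alpha}(F_s,F_t)$ for all $s,t$. A partial cut on $S$ is an ordered pair $(A,B)$ of disjoint subsets of $S$. Deleting $e=uv\in E\Gamma$ splits $\Gamma$ into components $\Gamma'_e\ni u$ and $\Gamma''_e$; $A_e=\{s:F_s\subseteq\Gamma'_e\}$, $B_e=\{s:F_s\subseteq\Gamma''_e\}$. *)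

(* Defs.v *)
From mathcomp Require Import all_boot all_order all_algebra.
From mathcomp Require Import boolp classical_sets reals.

Set Implicit Arguments.
Unset Strict Implicit.
Unset Printing Implicit Defensive.

Import Order.TTheory GRing.Theory Num.Theory.
Local Open Scope ring_scope.

(* The edge set of a digraph on a finite type V of nodes is E : {set V * V};
   (x, y) \in E is the edge xy from x to y.  Functions on a subset (capacities
   on EG, edge lengths on the tree, distances on S) are total functions of which
   only the values on that subset are constrained or used. *)

Definition is_max (R : realType) (A : set R) (m : R) : Prop :=
  A m /\ ubound A m.

Definition is_min (R : realType) (A : set R) (m : R) : Prop :=
  A m /\ lbound A m.

(* A path is stored as its first node together with the list of the others. *)

Definition path_start (V : finType) (P : V * seq V) : V := P.1.

Definition path_end (V : finType) (P : V * seq V) : V := last P.1 P.2.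

Definition path_nodes (V : finType) (P : V * seq V) : seq V := P.1 :: P.2.

Definition path_edges (V : finType) (P : V * seq V) : seq (V * V) :=
  zip (P.1 :: P.2) P.2.

Definition is_dipath (V : finType) (E : {set V * V}) (P : V * seq V) : Prop :=
  path [rel x y | (x, y) \in E] P.1 P.2 /\ uniq (path_nodes P).

Definition uadj (V : finType) (E : {set V * V}) : rel V :=
  [rel x y | ((x, y) \in E) || ((y, x) \in E)].

Definition is_upath (V : finType) (E : {set V * V}) (P : V * seq V) : Prop :=
  path (uadj E) P.1 P.2 /\ uniq (path_nodes P).

Definition out_capacity (V : finType) (E : {set V * V}) (c : V * V -> nat)
    (x : V) : nat :=
  (\sum_(e in E | e.1 == x) c e)%N.

Definition in_capacity (V : finType) (E : {set V * V}) (c : V * V -> nat)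
    (x : V) : nat :=
  (\sum_(e in E | e.2 == x) c e)%N.

Definition eulerian_at (V : finType) (E : {set V * V}) (c : V * V -> nat)
    (x : V) : Prop :=
  out_capacity E c x = in_capacity E c x.

Definition inner_eulerian (V : finType) (E : {set V * V}) (S : {set V})
    (c : V * V -> nat) : Prop :=
  forall x : V, x \notin S -> eulerian_at E c x.

Definition cut_capacity (V : finType) (E : {set V * V}) (c : V * V -> nat)
    (X : {set V}) : nat :=
  (\sum_(e in E | (e.1 \in X) && (e.2 \notin X)) c e)%N.

(* min {c(dX) : A \subset X \subset V \ B}.  When A and B are disjoint, which
   holds for the partial cuts below, X := A is feasible, so that the arg min is
   a genuine minimizer. *)
Definition min_cut (V : finType) (E : {set V * V}) (c : V * V -> nat)
    (A B : {set V}) : nat :=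
  cut_capacity E c
    [arg min_(X < A | (A \subset X) && (X \subset ~: B)) cut_capacity E c X]%N.

Record is_multiflow (R : realType) (V : finType) (E : {set V * V})
    (S : {set V}) (c : V * V -> nat)
    (Ps : seq (V * seq V)) (lam : V * seq V -> R) : Prop := IsMultiflow {
  mf_uniq : uniq Ps;
  mf_dipath : forall P, P \in Ps -> is_dipath E P;
  mf_terminals : forall P, P \in Ps ->
    [/\ path_start P \in S, path_end P \in S & path_start P != path_end P];
  mf_ge0 : forall P, P \in Ps -> 0 <= lam P;
  mf_capacity : forall e, e \in E ->
    \sum_(P <- Ps | e \in path_edges P) lam P <= (c e)%:R
}.

Definition is_integral_multiflow (R : realType) (V : finType)
    (E : {set V * V}) (S : {set V}) (c : V * V -> nat)
    (Ps : seq (V * seq V)) (lam : V * seq V -> R) : Prop :=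
  is_multiflow E S c Ps lam /\ forall P, P \in Ps -> lam P \is a Num.int.

Definition mf_value (R : realType) (V : finType) (mu : V -> V -> R)
    (Ps : seq (V * seq V)) (lam : V * seq V -> R) : R :=
  \sum_(P <- Ps) lam P * mu (path_start P) (path_end P).

Definition mfp_values (R : realType) (V : finType) (mu : V -> V -> R)
    (E : {set V * V}) (S : {set V}) (c : V * V -> nat) : set R :=
  [set z : R | exists Ps lam,
     is_multiflow E S c Ps lam /\ z = mf_value mu Ps lam]%classic.

Definition imfp_values (R : realType) (V : finType) (mu : V -> V -> R)
    (E : {set V * V}) (S : {set V}) (c : V * V -> nat) : set R :=
  [set z : R | exists Ps lam,
     is_integral_multiflow E S c Ps lam /\ z = mf_value mu Ps lam]%classic.

Definition directed_distance (R : realType) (V : finType) (S : {set V})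
    (mu : V -> V -> R) : Prop :=
  {in S &, forall s t, 0 <= mu s t} /\ {in S, forall s, mu s s = 0}.

Record subgraph (T : finType) := Subgraph {
  nodes : {set T};
  edges : {set T * T}
}.

Definition is_subgraph (T : finType) (E : {set T * T}) (F : subgraph T) : Prop :=
  edges F \subset E /\
  (forall e, e \in edges F -> e.1 \in nodes F /\ e.2 \in nodes F).

(* Nonempty, connected and without cycles: the third clause excludes the cycles
   of length one (loops) and two (pairs of antiparallel edges). *)
Definition underlying_tree (T : finType) (F : subgraph T) : Prop :=
  [/\ nodes F != finset.set0,
      {in nodes F &, forall u v, connect (uadj (edges F)) u v},
      (forall u v, (u, v) \in edges F -> (v, u) \notin edges F)
    & (forall s, ucycle (uadj (edges F)) s -> (size s <= 2)%N)].

Definition oriented_tree (T : finType) (E : {set T * T}) : Prop :=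
  underlying_tree (Subgraph [set: T]%SET E).

Definition is_subtree (T : finType) (E : {set T * T}) (F : subgraph T) : Prop :=
  is_subgraph E F /\ underlying_tree F.

Definition single_node (T : finType) (F : subgraph T) : Prop :=
  exists u, nodes F = [set u]%SET.

Definition directed_path (T : finType) (F : subgraph T) : Prop :=
  exists P : T * seq T,
    [/\ uniq (path_nodes P), nodes F =i path_nodes P & edges F =i path_edges P].

(* In an oriented tree there is exactly one P as below for all u and v. *)
Definition traverses (T : finType) (E : {set T * T}) (u v : T) (e : T * T) :
    Prop :=
  exists P, [/\ is_upath E P, path_start P = u, path_end P = v
              & e \in path_edges P].

Definition tree_dist (R : realType) (T : finType) (E : {set T * T})
    (alpha : T * T -> R) (u v : T) : R :=
  \sum_(e in E | `[< traverses E u v e >]) alpha e.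

Definition subtree_dists (R : realType) (T : finType) (E : {set T * T})
    (alpha : T * T -> R) (F F' : subgraph T) : set R :=
  [set z : R | exists u v,
     [/\ u \in nodes F, v \in nodes F' & z = tree_dist E alpha u v]]%classic.

Record tree_realization (R : realType) (V : finType) (S : {set V})
    (mu : V -> V -> R) (T : finType) (E : {set T * T}) (alpha : T * T -> R)
    (F : V -> subgraph T) : Prop := TreeRealization {
  tr_tree : oriented_tree E;
  tr_ge0 : forall e, e \in E -> 0 <= alpha e;
  tr_subtree : {in S, forall s, is_subtree E (F s)};
  tr_dist : {in S &, forall s t,
    is_min (subtree_dists E alpha (F s) (F t)) (mu s t)}
}.

Definition component (T : finType) (E : {set T * T}) (u : T) : {set T} :=
  [set v | connect (uadj E) u v]%SET.

(* A component of the tree minus e is an induced subgraph of it, so that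
   containment of a subtree can be tested on nodes. *)
Definition cut_tail (V T : finType) (S : {set V}) (E : {set T * T})
    (F : V -> subgraph T) (e : T * T) : {set V} :=
  [set s in S | nodes (F s) \subset component (E :\ e) e.1]%SET.

Definition cut_head (V T : finType) (S : {set V}) (E : {set T * T})
    (F : V -> subgraph T) (e : T * T) : {set V} :=
  [set s in S | nodes (F s) \subset component (E :\ e) e.2]%SET.

Definition location_costs (R : realType) (V : finType) (EG : {set V * V})
    (S : {set V}) (c : V * V -> nat) (T : finType) (E : {set T * T})
    (alpha : T * T -> R) (F : V -> subgraph T) : set R :=
  [set z : R | exists2 rho : V -> T,
     {in S, forall s, rho s \in nodes (F s)}
   & z = \sum_(e in EG) (c e)%:R * tree_dist E alpha (rho e.1) (rho e.2)]%classic.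

(* Main.v *)
(* By complementary slackness over the cuts of the tree, it suffices to find an
   integral multiflow that simultaneously saturates a minimum cut for each
   partial cut (A_e, B_e), together with minimum cuts X_e that come from a
   single location map.

   For two tree edges e and f, one side of e is contained in one side of f.
   Minimum cuts uncross accordingly: submodularity handles equally oriented
   edges; for opposite orientations the difference of the two cuts must be
   Eulerian, and its nodes are because the set F_s of a non-Eulerian terminal is
   a directed path, which cannot cross two opposed tree edges.

   Multiflow: start from the single arcs.  As long as an arc xy leaves a minimum
   cut X_e with x outside A_e or y outside B_e, uncrossing yields a second arc at
   that node which can be joined with xy into one walk without lowering any of
   the minimum cuts.  At the end every arc leaving X_e goes from A_e to B_e.

   Location: minimum cuts chosen extremal with respect to a root of the tree are
   laminar like the tree itself, so for each node x the sides of the tree edges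
   selected by x meet pairwise and, by the Helly property of subtrees, share a
   node of F_x. *)

Require Import Defs.
From mathcomp Require Import all_boot all_order all_algebra.
From mathcomp Require Import zify.

Set Implicit Arguments.
Unset Strict Implicit.
Unset Printing Implicit Defensive.

Import Order.TTheory GRing.Theory Num.Theory.
Local Open Scope ring_scope.

(** * Cuts and uncrossing *)

Section Cuts.
Local Open Scope nat_scope.
Local Open Scope set_scope.

Variable V : finType.
Implicit Types (D : seq (V * V)) (a : V * V) (X Y Z : {set V}) (x : V).

(* [b = false] reads arcs and cuts forwards, [b = true] backwards. *)
Definition tip (b : bool) a : V := if b then a.2 else a.1.

Definition leaves b X a := (tip b a \in X) && (tip (~~ b) a \notin X).

Definition dcut b D X : nat := count (leaves b X) D.

Definition balanced D x : bool :=
  count (fun a => a.1 == x) D == count (fun a => a.2 == x) D.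

(** These arcs are the defect in submodularity of cuts. *)
Definition crossing X Y a : bool :=
  [|| (a.1 \in X :\: Y) && (a.2 \in Y :\: X)
    | (a.1 \in Y :\: X) && (a.2 \in X :\: Y)].

Lemma dcutC b D X : dcut (~~ b) D (~: X) = dcut b D X.
Proof.
apply: eq_count => a; rewrite /leaves !inE negbK negbK andbC; by case: b.
Qed.

Lemma dcut_submod b D X Y :
  dcut b D X + dcut b D Y =
  dcut b D (X :&: Y) + dcut b D (X :|: Y) + count (crossing X Y) D.
Proof.
elim: D => //= -[u v] D; rewrite /dcut /leaves /crossing /tip /= !inE => IH.
case: b IH => /=; case: (u \in X); case: (u \in Y); case: (v \in X);
  case: (v \in Y) => /=; lia.
Qed.

(** For opposite readings submodularity fails only by arc ends in [X :\: Y]; the two counts of such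
    ends cancel as soon as the nodes there are balanced. *)
Lemma dcut_submod_opp b D X Y :
  dcut b D X + dcut (~~ b) D Y + count (fun a => tip (~~ b) a \in X :\: Y) D =
  dcut b D (X :&: Y) + dcut (~~ b) D (X :|: Y) + count (crossing X Y) D
  + count (fun a => tip b a \in X :\: Y) D.
Proof.
elim: D => //= -[u v] D; rewrite /dcut /leaves /crossing /tip /= !inE => IH.
case: b IH => /=; case: (u \in X); case: (u \in Y); case: (v \in X);
  case: (v \in Y) => /=; lia.
Qed.

Lemma count_tip_sum D (f : V * V -> V) Z :
  count (fun a => f a \in Z) D = \sum_(x in Z) count (fun a => f a == x) D.
Proof.
elim: D => [|a D IH] /=; first by rewrite big1.
rewrite IH big_split /=; congr addn.
case: (boolP (f a \in Z)) => faZ /=.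
  rewrite (bigD1 (f a)) //= eqxx big1 // => x /andP[_ /negbTE].
  by rewrite eq_sym => ->.
rewrite big1 // => x xZ; case: eqP => // fax.
by rewrite fax xZ in faZ.
Qed.

Lemma balanced_count b D Z : {in Z, forall x, balanced D x} ->
  count (fun a => tip b a \in Z) D = count (fun a => tip (~~ b) a \in Z) D.
Proof.
move=> balZ; rewrite !count_tip_sum; apply: eq_bigr => x /balZ /eqP.
by case: b.
Qed.

Lemma dcut_setU1 b D X x : x \notin X ->
  dcut b D (x |: X) + count (fun a => (tip b a \in X) && (tip (~~ b) a == x)) D =
  dcut b D X
  + count (fun a => (tip b a == x) && (tip (~~ b) a \notin x |: X)) D.
Proof.
move=> xX; elim: D => //= -[u v] D; rewrite /dcut /leaves /tip /= !inE => IH.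
case: b IH => /= IH; case: (eqVneq u x) => [->|_]; case: (eqVneq v x) => [->|_];
  rewrite ?(negbTE xX) /=; case: (u \in X); case: (v \in X); rewrite /=; lia.
Qed.

Lemma count_tip_split b D X x : x \notin X ->
  count (fun a => tip b a == x) D =
  count (fun a => (tip b a == x) && (tip (~~ b) a \in X)) D
  + count (fun a => (tip b a == x) && (tip (~~ b) a \notin x |: X)) D
  + count (fun a => (tip b a == x) && (tip (~~ b) a == x)) D.
Proof.
move=> xX; elim: D => //= -[u v] D ->; rewrite /tip !inE.
case: b => /=; case: (eqVneq u x) => [?|_]; case: (eqVneq v x) => [?|_];
  subst=> //=; rewrite ?(negbTE xX) ?andbF //=; try lia;
  case: (_ \in X) => /=; lia.
Qed.

End Cuts.

(** * Tight sets and splittable pairs of arcs *)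

Section Uncrossing.
Local Open Scope nat_scope.
Local Open Scope set_scope.

Variables (V T I : finType) (L : I -> {set T}) (F : V -> {set T}).
Implicit Types (P Q : I * bool) (X Y Z : {set V}).

(** A pair [(i, b)] names one of the two halves belonging to the tree edge [i]; the same [b] later
    orients the cut, so complementing a cut and switching the half change nothing. *)
Definition side (P : I * bool) : {set T} := if P.2 then ~: L P.1 else L P.1.

Definition opp (P : I * bool) : I * bool := (P.1, ~~ P.2).

Lemma oppK : involutive opp. Proof. by case=> i b; rewrite /opp /= negbK. Qed.

Lemma side_opp P : side (opp P) = ~: side P.
Proof. by case: P => i [] //=; rewrite /side /= setCK. Qed.

(** The sets competing in the minimum cut of a half, where [F x] is the set of admissible locations
    of [x]. *)
Definition feasible (P : I * bool) (X : {set V}) : bool :=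
  [forall x, ((F x \subset side P) ==> (x \in X))
          && ((F x \subset side (opp P)) ==> (x \notin X))].

Lemma feasibleP P X :
  reflect (forall x, (F x \subset side P -> x \in X)
                  /\ (F x \subset side (opp P) -> x \notin X))
          (feasible P X).
Proof.
apply: (iffP forallP) => H x; have := H x.
  by move=> /andP[/implyP ? /implyP].
by case=> ? ?; apply/andP; split; apply/implyP.
Qed.

Lemma feasibleC P X : feasible P X -> feasible (opp P) (~: X).
Proof.
move=> /feasibleP fX; apply/feasibleP => x; have [h1 h2] := fX x.
by rewrite oppK !inE negbK; split.
Qed.

Lemma feasibleI P Q X Y : side P \subset side Q ->
  feasible P X -> feasible Q Y -> feasible P (X :&: Y).
Proof.
move=> PQ /feasibleP fX /feasibleP fY; apply/feasibleP => x; rewrite inE.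
have [h1 h2] := fX x; have [h3 h4] := fY x; split=> [FP|/h2].
  by rewrite h1 ?h3 ?(subset_trans FP).
by move/negbTE ->.
Qed.

Lemma feasibleU P Q X Y : side P \subset side Q ->
  feasible P X -> feasible Q Y -> feasible Q (X :|: Y).
Proof.
move=> PQ fX fY; rewrite -[Q]oppK -[_ :|: _]setCK; apply: feasibleC.
by rewrite setCU setIC; apply: feasibleI (feasibleC fY) (feasibleC fX);
  rewrite !side_opp setCS.
Qed.

Variable D : seq (V * V).

Definition tight P X : bool :=
  feasible P X && [forall Y, feasible P Y ==> (dcut P.2 D X <= dcut P.2 D Y)].

Lemma tight_feasible P X : tight P X -> feasible P X.
Proof. by case/andP. Qed.

Lemma tight_le P X Y : tight P X -> feasible P Y -> dcut P.2 D X <= dcut P.2 D Y.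
Proof. by case/andP=> _ /forallP/(_ Y)/implyP. Qed.

Lemma tightE P X Y : tight P X -> feasible P Y ->
  dcut P.2 D Y <= dcut P.2 D X -> tight P Y.
Proof.
move=> tX fY YX; apply/andP; split=> //; apply/forallP => Z; apply/implyP => fZ.
exact: leq_trans YX (tight_le tX fZ).
Qed.

Lemma tightC P X : tight P X -> tight (opp P) (~: X).
Proof.
move=> tX; apply/andP; split; first exact: feasibleC (tight_feasible tX).
apply/forallP => Y; apply/implyP => /feasibleC; rewrite oppK => fY.
have := tight_le tX fY; rewrite -(dcutC P.2) -(dcutC P.2 D (~: Y)) setCK.
by [].
Qed.

Hypothesis balF : forall x P Q, P.2 != Q.2 -> side P \subset side Q ->
  [|| balanced D x, F x \subset side (opp P) | F x \subset side Q].

(** Minimality of [X] and [Y] turns submodularity into equality and kills the crossing term. For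
    opposite orientations, feasibility excludes both inclusions in [balF] for a node of [X :\: Y],
    so that node is balanced. *)
Lemma uncross P Q X Y : side P \subset side Q -> tight P X -> tight Q Y ->
  [/\ tight P (X :&: Y), tight Q (X :|: Y) & ~~ has (crossing X Y) D].
Proof.
move=> PQ tX tY.
have fI := feasibleI PQ (tight_feasible tX) (tight_feasible tY).
have fU := feasibleU PQ (tight_feasible tX) (tight_feasible tY).
have leI := tight_le tX fI; have leU := tight_le tY fU.
suff E : dcut P.2 D X + dcut Q.2 D Y =
    dcut P.2 D (X :&: Y) + dcut Q.2 D (X :|: Y) + count (crossing X Y) D.
  rewrite has_count; split; last by lia.
    by apply: (tightE tX fI); lia.
  by apply: (tightE tY fU); lia.
have [<-|PQ2] := eqVneq P.2 Q.2; first exact: dcut_submod.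
have -> : Q.2 = ~~ P.2 by case: P.2 Q.2 PQ2 => [] [].
have := dcut_submod_opp P.2 D X Y; rewrite (@balanced_count _ P.2).
  by lia.
move=> x; rewrite inE => /andP[xY xX].
case/or3P: (balF x PQ2 PQ) => // FP.
  have /feasibleP/(_ x)[_ /(_ FP)] := tight_feasible tX; by rewrite xX.
by have /feasibleP/(_ x)[/(_ FP)] := tight_feasible tY; rewrite (negbTE xY).
Qed.

Hypothesis side_neq0 : forall P, side P != set0.

Hypothesis cross_free : forall P Q,
  [|| side P \subset side Q, side Q \subset side P,
      side P \subset side (opp Q) | side (opp P) \subset side Q].

(** Replacing the arcs [zx] and [xy] by [zy] lowers a cut only if the set separates [x] from both
    [z] and [y]. Sets containing [x] are covered through their complements, which are tight for the
    opposite half. *)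
Definition splittable x z y : bool :=
  [forall R : (I * bool) * {set V}, tight R.1 R.2 && (x \notin R.2) ==>
     ~~ ((z \in R.2) && (y \in R.2))].

Lemma splittablePn x z y : ~~ splittable x z y ->
  exists Q Y, [/\ tight Q Y, x \notin Y, z \in Y & y \in Y].
Proof.
case/forallPn => -[Q Y] /=; rewrite negb_imply negbK.
by case/andP => /andP[? ?] /andP[? ?]; exists Q, Y.
Qed.

(** If no arc reaching [x] could be joined with [a], then moving [x] out of a smallest tight set, or
    into a largest blocking one, would give a feasible set with a smaller cut. All arcs are read in
    the direction [P.2]. *)
Lemma exists_splittable P X a : a \in D -> tight P X -> leaves P.2 X a ->
  ~~ (F (tip P.2 a) \subset side P) ->
  has (fun a' => [&& tip (~~ P.2) a' == tip P.2 a, tip P.2 a' != tip P.2 a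
        & splittable (tip P.2 a) (tip P.2 a') (tip (~~ P.2) a)]) D.
Proof.
move=> aD; have [b Pb] : exists b, P.2 = b by exists P.2.
rewrite Pb; set x := tip b a; set y := tip (~~ b) a => tX Xa xP.
apply/negPn/negP => /hasPn blocked.
have {}blocked a' : a' \in D -> tip (~~ b) a' = x -> tip b a' != x ->
    exists Q Y, [/\ tight Q Y, x \notin Y, tip b a' \in Y & y \in Y].
  move=> a'D a'x a'nx; apply: splittablePn.
  by have := blocked _ a'D; rewrite a'x eqxx a'nx.
have noX (X' Y' : {set V}) : ~~ has (crossing X' Y') D ->
    x \in X' :\: Y' -> y \in Y' :\: X' -> False.
  move=> /hasPn/(_ a aD) + xX yY; rewrite /crossing.
  by move: xX yY; rewrite /x /y /tip; case: (b) => /= -> -> //=; rewrite orbT.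
(* The condition on [F x] ensures that removing [x] from the set keeps it feasible. *)
pose good (R : (I * bool) * {set V}) := [&& R.1.2 == b, tight R.1 R.2,
   x \in R.2, y \notin R.2 & ~~ (F x \subset side R.1)].
have: good (P, X).
  by rewrite /good /= Pb eqxx tX xP andbT; exact: Xa.
move=> gPX.
case: (arg_minnP (fun R : (I * bool) * {set V} => #|R.2|) gPX) => -[P1 X1] /=.
move: {P X Pb Xa tX xP gPX} P1 X1 => P X.
case/and5P => /= /eqP Pb tX xX yX xP minX.
have {}minX Q Y : Q.2 = b -> tight Q Y -> x \in Y -> Y \subset X ->
    ~~ (F x \subset side Q) -> X \subset Y.
  move=> Qb tY xY YX xQ; suff -> : X = Y by [].
  apply/esym/eqP; rewrite eqEcard YX (minX (Q, Y)) // /good /= Qb eqxx tY xY xQ.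
  by rewrite andbT; apply: contra yX; apply: (fintype.subsetP YX).
(* If [P] and [Q] cover the tree and are equally oriented, minimality of [X] does
   not apply; these [Y] are instead merged into one containing every in-neighbour
   of [x], and then adding [x] to it contradicts balance at [x]. *)
pose hard (R : (I * bool) * {set V}) := [&& R.1.2 == b, tight R.1 R.2,
   x \notin R.2, ~: X \subset R.2 & side (opp P) \subset side R.1].
have hardE a' : a' \in D -> tip (~~ b) a' = x -> tip b a' != x ->
    tip b a' \in X -> exists2 R, hard R & tip b a' \in R.2.
  move=> a'D a'x a'nx a'X; have [Q [Y [tY xY zY yY]]] := blocked _ a'D a'x a'nx.
  have [PQ|PQ|PQ|PQ] := or4P (cross_free P Q).
  - by have [_ _ /noX] := uncross PQ tX tY; rewrite !inE xX xY yX yY => /(_ isT isT).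
  - have [_ _] := uncross PQ tY tX; rewrite /crossing => nc.
    case: (@noX X Y); rewrite ?inE ?xX ?xY ?yX ?yY //.
    by apply: contra nc; apply: sub_has => e /=; rewrite orbC.
  (* [X] without [Y] is again a competitor, but misses the start of [a']. *)
  - have [tI _ _] := uncross PQ tX (tightC tY).
    have := minX _ _ Pb tI; rewrite !inE xX xY subsetIl xP => /(_ isT isT isT).
    by move/fintype.subsetP/(_ _ a'X); rewrite !inE zY andbF.
  - have QP : side (opp Q) \subset side P.
      by rewrite -[side P]setCK -side_opp side_opp setCS.
    have [tI _ _] := uncross QP (tightC tY) tX.
    have [Qb|Qb] := eqVneq Q.2 b; last first.
      have oQb : (opp Q).2 = b by move: Qb => /=; case: (Q.2) (b) => [] [].
      have := minX _ _ oQb tI; rewrite !inE xX xY subsetIr => /(_ isT isT).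
      have -> : ~~ (F x \subset side (opp Q)).
        by apply: contra xP => /subset_trans; apply.
      by move=> /(_ isT)/fintype.subsetP/(_ _ a'X); rewrite !inE zY.
    have [_ tU _] := uncross PQ (tightC tX) tY.
    exists (Q, ~: X :|: Y); last by rewrite /= !inE zY orbT.
    by rewrite /hard /= Qb eqxx tU !inE xX (negbTE xY) finset.subsetUl PQ.
have fX := tight_feasible tX.
have fXx : feasible P (X :\ x).
  apply/feasibleP => v; have [h1 h2] := feasibleP _ _ fX v.
  rewrite !inE negb_and negbK; split=> [Fv|/h2 ->]; last by rewrite orbT.
  by rewrite h1 // andbT; apply: contraNneq xP => <-.
have outX : 0 < count (fun e => (tip b e == x) && (tip (~~ b) e \notin X)) D.
  rewrite -has_count; apply/hasP; exists a => //=; by rewrite eqxx.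
(* If nothing reaches [x] from the rest of [X], removing [x] drops [a] from the cut and adds no
   arc. *)
have [/hasP[a' a'D /and3P[/eqP a'x a'nx a'X]]|/hasPn noin] := boolP (has (fun e =>
    [&& tip (~~ b) e == x, tip b e != x & tip b e \in X]) D); last first.
  have := tight_le tX fXx; have := @dcut_setU1 _ b D (X :\ x) x.
  rewrite Pb setD1K // !inE eqxx => /(_ isT).
  have -> : count (fun e => (tip b e \in X :\ x) && (tip (~~ b) e == x)) D = 0.
    apply/eqP; rewrite -leqn0 leqNgt -has_count; apply/hasPn => e /noin.
    by apply: contra => /andP[]; rewrite !inE => /andP[-> ->] ->.
  by move: outX; clear; lia.
have [R hR _] := hardE _ a'D a'x a'nx a'X.
case: (arg_maxnP (fun R : (I * bool) * {set V} => #|R.2|) hR) => -[Q Y] /=.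
case/and5P => /= /eqP Qb tY xY XY PQ maxY.
have allY e : e \in D -> tip (~~ b) e = x -> tip b e != x -> tip b e \in Y.
  move=> eD ex enx; have [eX|eX] := boolP (tip b e \in X); last first.
    by apply: (fintype.subsetP XY); rewrite inE.
  have [[Q' Y'] hR' /= eY'] := hardE _ eD ex enx eX.
  case/and5P: (hR') => /= /eqP Qb' tY' xY' XY' PQ'.
  have maxU Q'' : Q''.2 = b -> side (opp P) \subset side Q'' ->
      tight Q'' (Y :|: Y') -> tip b e \in Y.
    move=> Qb'' PQ'' tU; have := maxY (Q'', Y :|: Y'); rewrite /hard /= Qb'' eqxx tU.
    rewrite PQ'' inE negb_or xY xY' (subset_trans XY) ?finset.subsetUl // => /(_ isT).
    move=> leU; suff -> : Y = Y :|: Y' by rewrite inE eY' orbT.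
    by apply/eqP; rewrite eqEcard finset.subsetUl.
  have [QQ|QQ|QQ|QQ] := or4P (cross_free Q Q').
  - by have [_ tU _] := uncross QQ tY tY'; apply: maxU tU.
  - have [_ tU _] := uncross QQ tY' tY; rewrite finset.setUC in tU.
    exact: maxU tU.
  (* Both halves contain the nonempty half opposite to [P], so they are not disjoint. *)
  - have [t tP] := finset.set0Pn _ (side_neq0 (opp P)).
    have := fintype.subsetP QQ t (fintype.subsetP PQ t tP).
    by rewrite side_opp inE (fintype.subsetP PQ' t tP).
  - have [_ _ /noX] := uncross QQ (tightC tY) tY'.
    have yY : y \in Y by apply: (fintype.subsetP XY); rewrite inE.
    have yY' : y \in Y' by apply: (fintype.subsetP XY'); rewrite inE.
    by rewrite !inE xY xY' yY yY' => /(_ isT isT).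
have fY := tight_feasible tY.
have xQ : ~~ (F x \subset side Q).
  by apply/negP => /(proj1 (feasibleP _ _ fY x)); rewrite (negbTE xY).
have fYx : feasible Q (x |: Y).
  apply/feasibleP => v; have [h1 h2] := feasibleP _ _ fY v.
  rewrite !inE negb_or; split=> [/h1 ->|Fv]; first by rewrite orbT.
  rewrite h2 // andbT; apply: contraNneq xP => <-.
  by apply: subset_trans Fv _; rewrite -[side P]setCK -side_opp side_opp setCS.
have balx : balanced D x.
  have := @balF x (opp P) Q; rewrite oppK (negbTE xP) (negbTE xQ) !orbF.
  by apply=> //=; rewrite Pb Qb; case: (b).
(* Apart from loops, all arcs into [x] come from [Y], and equally many leave [x]. One of the latter,
   [a], goes into [Y], so adding [x] to [Y] removes more arcs from the cut than it adds. *)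
have := tight_le tY fYx; have := @dcut_setU1 _ b D Y x xY; rewrite Qb.
have: count (fun e => tip b e == x) D = count (fun e => tip (~~ b) e == x) D.
  by move/eqP: balx; rewrite /tip; case: (b).
have yY : y \in Y by apply: (fintype.subsetP XY); rewrite inE.
have -> : count (fun e => tip (~~ b) e == x) D =
   count (fun e => (tip b e \in Y) && (tip (~~ b) e == x)) D + count (fun e => (tip b e == x) && (tip (~~ b) e == x)) D.
  rewrite -count_predUI [X in _ + X](_ : _ = 0) ?addn0; last first.
    apply/eqP; rewrite -leqn0 leqNgt -has_count; apply/hasPn => e _ /=.
    by apply/negP => /andP[/andP[eY _] /andP[/eqP ex _]]; rewrite ex (negbTE xY) in eY.
  apply: eq_in_count => e eD /=.
  have [ex|] := eqVneq (tip (~~ b) e) x; rewrite ?andbF // !andbT.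
  by have [//|/(allY _ eD ex) ->] := eqVneq (tip b e) x; rewrite ?orbT.
rewrite (count_tip_split b D xY).
have : 0 < count (fun e => (tip b e == x) && (tip (~~ b) e \in Y)) D.
  by rewrite -has_count; apply/hasP; exists a; rewrite //= eqxx.
by clear; lia.
Qed.

Lemma splittableC x z y : splittable x z y = splittable x y z.
Proof. by apply: eq_forallb => R; rewrite [(z \in _) && _]andbC. Qed.

Lemma splittable_tight P X x z y : splittable x z y -> tight P X ->
  ~~ [|| [&& z \in X, x \notin X & y \in X] | [&& z \notin X, x \in X & y \notin X]].
Proof.
move=> /forallP s tX; have /= := s (P, X); have /= := s (opp P, ~: X).
rewrite tX (tightC tX) !inE !negbK.
by case: (z \in X); case: (x \in X); case: (y \in X).
Qed.

(** An arc of the cut whose tail is not confined to [L i] can be extended at its tail; one whose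
    head is not confined to the complement can be extended at its head, by reading backwards from
    [~: X]. *)
Lemma splittable_or_locked i X : tight (i, false) X ->
  (exists z x y, [/\ (z, x) \in D, (x, y) \in D, (z, x) != (x, y)
     & splittable x z y])
  \/ dcut false D X
     <= count (fun a => (F a.1 \subset L i) && (F a.2 \subset ~: L i)) D.
Proof.
move=> tX; have [/hasP[a aD /andP[aX]]|/hasPn nD] := boolP (has (fun a =>
  leaves false X a && ~~ ((F a.1 \subset L i) && (F a.2 \subset ~: L i))) D); last first.
  right; rewrite /dcut (@eq_in_count _ _ (fun a => leaves false X a &&
    ((F a.1 \subset L i) && (F a.2 \subset ~: L i)))).
    by apply: sub_count => a /andP[].
  by move=> a /nD; rewrite negb_and negbK; case: leaves.
rewrite negb_and => /orP[a1|a2]; left.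
  have /hasP[[z x] zxD /and3P[/= /eqP xa za spl]] := exists_splittable aD tX aX a1.
  exists z, a.1, a.2; move: zxD; rewrite /tip /= xa -surjective_pairing => zxD.
  split=> //; by apply: contra za => /eqP/(congr1 fst)/= ->.
have aXC : leaves true (~: X) a.
  by move: aX; rewrite /leaves /tip /= !inE negbK andbC.
have /hasP[[x y] xyD /and3P[/= /eqP xa ya spl]] :=
  @exists_splittable (opp (i, false)) _ _ aD (tightC tX) aXC a2.
exists a.1, a.2, y; move: xyD; rewrite /tip /= in xa spl ya *.
rewrite xa -surjective_pairing => xyD; split=> //; last by rewrite splittableC.
by apply: contra ya => /eqP/(congr1 snd)/= <-.
Qed.

End Uncrossing.

(** * Joining arcs into walks *)

Section Locking.
Local Open Scope nat_scope.
Local Open Scope set_scope.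

Variables (V T I : finType) (L : I -> {set T}) (F : V -> {set T}).

Implicit Types D : seq (V * V).

(** Each walk acts as a single arc, so joining two walks is splitting off a pair of arcs. *)
Definition walk_ends (ws : seq (V * seq V)) : seq (V * V) :=
  [seq (path_start w, path_end w) | w <- ws].

Definition walk_edges (ws : seq (V * seq V)) : seq (V * V) :=
  flatten [seq path_edges w | w <- ws].

Definition cat_walk (w1 w2 : V * seq V) : V * seq V := (w1.1, w1.2 ++ w2.2).

Lemma path_edges_cat w1 w2 : path_end w1 = path_start w2 ->
  path_edges (cat_walk w1 w2) = path_edges w1 ++ path_edges w2.
Proof.
case: w1 w2 => [x s] [y t]; rewrite /path_edges /path_end /path_start /=.
by elim: s x => [|z s IH] x /= => [->|/IH ->].
Qed.

Lemma path_end_cat w1 w2 : path_end w1 = path_start w2 ->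
  path_end (cat_walk w1 w2) = path_end w2.
Proof. by rewrite /path_end /path_start /= last_cat => ->. Qed.

Lemma dcut_split b D (X : {set V}) z x y :
  ~~ [|| [&& z \in X, x \notin X & y \in X] | [&& z \notin X, x \in X & y \notin X]] ->
  dcut b ((z, x) :: (x, y) :: D) X = dcut b ((z, y) :: D) X.
Proof.
rewrite /dcut /leaves /tip /=; case: b;
  by case: (z \in X); case: (x \in X); case: (y \in X).
Qed.

(** Meant for feasible sets that are not tight: their cuts exceed the minimum by at least one, so
    one replacement cannot bring them below it. *)
Lemma dcut_split_le b D (X : {set V}) z x y :
  dcut b ((z, x) :: (x, y) :: D) X <= (dcut b ((z, y) :: D) X).+1.
Proof.
rewrite /dcut /leaves /tip /=; case: b;
  case: (z \in X); case: (x \in X); case: (y \in X) => /=; lia.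
Qed.

Lemma balanced_split D z x y v :
  balanced ((z, y) :: D) v = balanced ((z, x) :: (x, y) :: D) v.
Proof. rewrite /balanced /=; apply/eqP/eqP; lia. Qed.

Hypothesis side_neq0 : forall P, side L P != set0.

Hypothesis cross_free : forall P Q,
  [|| side L P \subset side L Q, side L Q \subset side L P,
      side L P \subset side L (opp Q) | side L (opp P) \subset side L Q].

Variable X : I -> {set V}.

(** Induction on the number of walks. While some [i] violates the bound, a splittable pair is
    joined; this preserves the edges used, the balances and the cuts of tight sets, so every [X i]
    stays tight. *)
Lemma walk_locking ws :
  (forall x P Q, P.2 != Q.2 -> side L P \subset side L Q ->
     [|| balanced (walk_ends ws) x, F x \subset side L (opp P)
       | F x \subset side L Q]) ->
  (forall i, tight L F (walk_ends ws) (i, false) (X i)) ->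
  exists2 ws', perm_eq (walk_edges ws') (walk_edges ws)
    & forall i, dcut false (walk_ends ws) (X i)
       <= count (fun a => (F a.1 \subset L i) && (F a.2 \subset ~: L i))
            (walk_ends ws').
Proof.
have [n] := ubnP (size ws); elim: n ws => // n IH ws szn bal tX.
have [/forallP lock|/forallPn[i]] := boolP [forall i, dcut false (walk_ends ws) (X i)
  <= count (fun a => (F a.1 \subset L i) && (F a.2 \subset ~: L i)) (walk_ends ws)].
  by exists ws.
have [|-> //] := splittable_or_locked bal side_neq0 cross_free (tX i).
move=> [z [x [y [/mapP[w1 w1in [z1 x1]] /mapP[w2 w2in [x2 y2]] neq spl]]]] _.
have neq12 : w2 != w1.
  apply: contraNneq neq => E; apply/eqP.
  by congr pair; [rewrite z1 x2 E | rewrite x1 y2 E].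
pose rest := rem w2 (rem w1 ws).
have pws : perm_eq ws [:: w1, w2 & rest].
  rewrite (permPl (perm_to_rem w1in)) perm_cons perm_to_rem //.
  by have := perm_mem (perm_to_rem w1in) w2; rewrite w2in inE (negbTE neq12).
pose ws1 := cat_walk w1 w2 :: rest.
have e12 : path_end w1 = path_start w2 by rewrite -x1.
have pD : perm_eq (walk_ends ws) [:: (z, x), (x, y) & walk_ends rest].
  rewrite (permPl (perm_map _ pws)) /= -z1 -x1 -x2 -y2; exact: perm_refl.
have D1 : walk_ends ws1 = (z, y) :: walk_ends rest.
  by rewrite /walk_ends /= path_end_cat // -y2 z1.
have dX i0 : dcut false (walk_ends ws1) (X i0) = dcut false (walk_ends ws) (X i0).
  rewrite D1 {2}/dcut (permP pD); apply/esym/dcut_split.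
  exact: splittable_tight spl (tX i0).
have [|||ws' pws' lock] := IH ws1.
- by move: szn; rewrite (perm_size pws) /=; lia.
- move=> v P Q PQ2 PQ; have := bal v P Q PQ2 PQ.
  by rewrite D1 (@balanced_split _ z x) /balanced !(permP pD).
- move=> j; apply/andP; split; first exact: tight_feasible (tX j).
  apply/forallP => Y; apply/implyP => fY; rewrite [(j, false).2]/= dX.
  have [tY|ntY] := boolP (tight L F (walk_ends ws) (j, false) Y).
    rewrite D1 -(dcut_split _ _ (splittable_tight spl tY)).
    by rewrite {2}/dcut -(permP pD); apply: tight_le (tX j) fY.
  have := dcut_split_le false (walk_ends rest) Y z x y.
  rewrite -D1 {1}/dcut -(permP pD) -/(dcut _ _ _) => le1.
  have lt1 : dcut false (walk_ends ws) (X j) < dcut false (walk_ends ws) Y.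
    by rewrite ltnNge; apply: contra ntY; apply: tightE (tX j) fY.
  by rewrite -ltnS; apply: leq_trans le1.
exists ws'; last by move=> j; rewrite -dX.
rewrite (permPl pws') perm_sym /walk_edges (permPl (perm_flatten (perm_map _ pws))) /=.
by rewrite path_edges_cat // catA perm_refl.
Qed.

End Locking.

(** * Sides of tree edges *)

Section Tree.
Local Open Scope nat_scope.
Local Open Scope set_scope.

Variables (T : finType) (E : {set T * T}).
Hypothesis treeE : oriented_tree E.
Implicit Types (e f : T * T) (u v : T) (G : {set T * T}).

Definition tail_side e : {set T} := component (E :\ e) e.1.

Lemma uadj_sym G : symmetric (uadj G).
Proof. by move=> u v; rewrite /uadj /= orbC. Qed.

Lemma uadj_connect_sym G : connect_sym (uadj G).
Proof. exact/sym_connect_sym/uadj_sym. Qed.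

Lemma tree_anti u v : (u, v) \in E -> (v, u) \notin E.
Proof. by case: treeE => _ _ + _; apply. Qed.

Lemma tail_side_edge e f : f \in E -> f != e ->
  (f.1 \in tail_side e) = (f.2 \in tail_side e).
Proof.
move=> fE fe; rewrite !inE; apply: (same_connect_r (@uadj_connect_sym _)).
by apply: connect1; rewrite /uadj /= !inE -surjective_pairing fe fE.
Qed.

Lemma tail_in_side e : e.1 \in tail_side e.
Proof. by rewrite inE. Qed.

(** A path between the ends of [e] avoiding [e] would close up with [e] to a cycle; loops and
    antiparallel edges are treated apart, since [ucycle] bounds only the longer ones. *)
Lemma head_notin_side e : e \in E -> e.2 \notin tail_side e.
Proof.
case: e => a b eE; rewrite inE /=; apply/negP => /connectP[p0 p0P].
case/shortenP: p0P => p pP pU _ b_last; clear p0.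
have [_ _ _ /(_ (a :: p))] := treeE; rewrite /= /ucycle /cycle pU andbT rcons_path.
have subE : subrel (uadj (E :\ (a, b))) (uadj E).
  by move=> u v; rewrite /uadj /= !inE => /orP[] /andP[_ ->]; rewrite ?orbT.
rewrite (sub_path subE pP) -b_last /uadj /= eE orbT => /(_ isT).
case: p pP b_last {pU} => [|c [|//]] /=.
  by move=> _ ba; subst b; have := tree_anti eE; rewrite eE.
move=> + bc; subst c; rewrite andbT /uadj /= !inE eqxx /=.
by rewrite (negbTE (tree_anti eE)) andbF.
Qed.

(* Only [e] joins its two sides, so a connected edge set meeting both contains
   it. *)
Lemma connect_cross G e u v : G \subset E -> connect (uadj G) u v ->
  u \in tail_side e -> v \notin tail_side e -> e \in G.
Proof.
move=> GE uv ue ve; apply: contraNT ve => eG.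
rewrite -(closed_connect _ uv) //; apply: intro_closed.
  exact: uadj_connect_sym.
move=> x y /orP[] xyG xe; have xyE := fintype.subsetP GE _ xyG.
  have /(tail_side_edge xyE) /= <- // : (x, y) != e.
  by apply: contraNneq eG => <-.
have /(tail_side_edge xyE) /= -> // : (y, x) != e.
by apply: contraNneq eG => <-.
Qed.

Lemma tree_connect u v : connect (uadj E) u v.
Proof. by case: treeE => _ + _ _; apply; rewrite inE. Qed.

Lemma component_head e : e \in E -> component (E :\ e) e.2 = ~: tail_side e.
Proof.
move=> eE; apply/setP => v; rewrite !inE; apply/idP/idP => [e2v|e1v].
  apply: contra (head_notin_side eE) => e1v; rewrite inE.
  by apply: connect_trans e1v _; rewrite uadj_connect_sym.
pose a := [pred w | connect (uadj (E :\ e)) e.1 w || connect (uadj (E :\ e)) e.2 w].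
have : v \in a.
  rewrite -(closed_connect _ (tree_connect e.1 v)) ?inE ?connect0 //.
  apply: intro_closed; first exact: uadj_connect_sym.
  move=> x y; have [xye|xye] := eqVneq (x, y) e.
    by subst e; move=> _ _; rewrite !inE /= connect0 orbT.
  have [yxe|yxe] := eqVneq (y, x) e; first by subst e; move=> _ _; rewrite !inE /= connect0.
  move=> xy; have xy' : uadj (E :\ e) x y by rewrite /uadj /= !inE xye yxe.
  by rewrite !inE => /orP[] /connect_trans/(_ (connect1 xy')) ->; rewrite ?orbT.
by rewrite !inE (negbTE e1v).
Qed.

Definition tree_edge := {e : T * T | e \in E}.

Definition edge_side (i : tree_edge) : {set T} := tail_side (val i).

Notation half := (side edge_side).

Definition near_end (P : tree_edge * bool) : T :=
  if P.2 then (val P.1).2 else (val P.1).1.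

Definition far_end (P : tree_edge * bool) : T :=
  if P.2 then (val P.1).1 else (val P.1).2.

Lemma near_end_in P : near_end P \in half P.
Proof.
case: P => [[e eE] []]; rewrite /side /near_end /= /edge_side /= ?tail_in_side //.
by rewrite inE head_notin_side.
Qed.

Lemma far_end_notin P : far_end P \notin half P.
Proof.
case: P => [[e eE] []]; rewrite /side /far_end /= /edge_side /= ?head_notin_side //.
by rewrite inE negbK tail_in_side.
Qed.

Lemma half_neq0 P : half P != set0.
Proof. by apply/finset.set0Pn; exists (near_end P); apply: near_end_in. Qed.

Lemma half_ends P Q : Q.1 != P.1 -> (near_end Q \in half P) = (far_end Q \in half P).
Proof.
case: P Q => [[e eE] b] [[f fE] d]; rewrite -val_eqE /= => fe.
have := tail_side_edge fE fe; rewrite /near_end /far_end /side /edge_side /=.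
by case: b d => [] [] /=; rewrite ?inE => ->.
Qed.

Lemma half_connected P v : v \in half P ->
  connect (uadj (E :\ val P.1)) (near_end P) v.
Proof.
case: P => [[e eE] []]; rewrite /side /near_end /= /edge_side /=.
  by rewrite -component_head // inE.
by rewrite inE.
Qed.

(** [half P] is connected without the edge [P.1] and contains no end of [Q.1], so a walk in it from
    [near_end P] never leaves [half Q]. *)
Lemma half_subset P Q : near_end Q \notin half P -> far_end Q \notin half P ->
  near_end P \in half Q -> half P \subset half Q.
Proof.
move=> nQ fQ PQ; apply/fintype.subsetP => v vP.
suff : v \in [predI half P & half Q] by case/andP.
rewrite -(closed_connect _ (half_connected vP)) ?inE ?near_end_in //.
apply: intro_closed; first exact: uadj_connect_sym.
have step x y : (x, y) \in E :\ val P.1 ->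
    (x \in [predI half P & half Q]) = (y \in [predI half P & half Q]).
  rewrite !inE => /andP[xyP xyE]; pose g : tree_edge := Sub (x, y) xyE.
  have := @half_ends P (g, false); rewrite /near_end /far_end /= -val_eqE => /(_ xyP) xP.
  rewrite xP; have [yP|//] := boolP (y \in half P).
  apply: (@half_ends Q (g, false)); rewrite /= -val_eqE.
  apply: contraNneq nQ => gQ; rewrite /near_end -gQ /=.
  by case: Q.2; rewrite ?xP.
by move=> x y /orP[/step ->|/step ->].
Qed.

(** An edge [Q.1] other than [P.1] has both ends in one half of [P.1]; the other half then lies
    inside one half of [Q.1]. *)
Lemma half_cross_free P Q : [|| half P \subset half Q, half Q \subset half P,
  half P \subset half (opp Q) | half (opp P) \subset half Q].
Proof.
have [PQ|PQ] := eqVneq P.1 Q.1.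
  case: P Q PQ => [i b] [j d] /= ->; rewrite /side /opp /=.
  by case: b d => [] [] /=; rewrite !subxx ?orbT.
have fQ R R' : R.1 = P.1 -> R'.1 = Q.1 -> far_end R' \in half R = (near_end R' \in half R).
  by move=> RP RQ; rewrite half_ends // RP RQ eq_sym.
have nP R R' : R.1 = P.1 -> R'.1 = Q.1 -> near_end R' \notin half R ->
    half R \subset half Q \/ half R \subset half (opp Q).
  move=> RP RQ nR.
  have nQ : near_end Q \notin half R /\ far_end Q \notin half R.
    move: nR; have := fQ R Q RP erefl; rewrite /near_end /far_end RQ.
    by case: R'.2; case: Q.2 => ->; move=> ->.
  have [PQ'|PQ'] := boolP (near_end R \in half Q).
    by left; apply: half_subset => //; case: nQ.
  right; apply: half_subset; rewrite ?side_opp ?inE //.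
    by move: (proj2 nQ); rewrite /far_end /near_end /=; case: Q.2.
  by move: (proj1 nQ); rewrite /far_end /near_end /=; case: Q.2.
have [nQP|nQP] := boolP (near_end Q \in half P).
  have [|->|H] := nP (opp P) Q erefl erefl.
  - by rewrite side_opp inE nQP.
  - by rewrite !orbT.
  - have -> : half Q \subset half P; last by rewrite orbT.
    by rewrite -[half Q]setCK -[half P]setCK setCS -!side_opp.
by have [->|->] := nP P Q erefl erefl nQP; rewrite ?orbT.
Qed.

(* For Helly arguments: moving a node across an edge towards a half meeting a
   second one never leaves that second half. *)
Lemma half_gate P Q t : t \in half Q -> t \notin half P ->
  half P :&: half Q != set0 -> near_end P \in half Q.
Proof.
move=> tQ tP PQ; apply/negPn/negP => nQ.
have PQ1 : P.1 != Q.1.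
  apply: contraTneq nQ => PQ1; rewrite negbK; move: PQ tQ tP.
  case: P Q PQ1 => [i b] [j d] /= ->; have [->|bd] := eqVneq b d.
    by rewrite near_end_in.
  have -> : (j, b) = opp (j, d) by rewrite /opp /=; case: b d bd => [] [].
  by rewrite side_opp finset.setIC setICr eqxx.
have fQ : far_end P \notin half Q by rewrite -half_ends.
have [near|near] := boolP (near_end Q \in half P).
  by move/fintype.subsetP/(_ t tQ): (half_subset nQ fQ near); rewrite (negbTE tP).
have /fintype.subsetP QP : half Q \subset half (opp P).
  apply: half_subset; rewrite ?side_opp ?inE //.
    by move: fQ; rewrite /far_end /near_end /=; case: P.2.
  by move: nQ; rewrite /far_end /near_end /=; case: P.2.
have [w] := finset.set0Pn _ PQ; rewrite inE => /andP[wP /QP].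
by rewrite side_opp inE wP.
Qed.

(** The subtree is connected by its own edges and meets both halves, so it contains the edge
    [P.1]. *)
Lemma subtree_crosses (F : subgraph T) P : is_subtree E F ->
  ~~ (nodes F \subset half P) -> ~~ (nodes F \subset half (opp P)) ->
  near_end P \in nodes F /\ far_end P \in nodes F.
Proof.
case=> -[FE Fends] [_ Fconn _ _] /subsetPn[u uF uP] /subsetPn[v vF].
rewrite side_opp inE negbK => vP.
suff /Fends[] : val P.1 \in edges F by rewrite /near_end /far_end; case: P.2.
case: P uP vP => [i []]; rewrite /side /= ?in_setC ?negbK => uP vP.
  exact: connect_cross FE (Fconn u v uF vF) uP vP.
exact: connect_cross FE (Fconn v u vF uF) vP uP.
Qed.

Lemma mem_path_edges (x : T) p e : e \in zip (x :: p) p ->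
  e.1 \in x :: p /\ e.2 \in p.
Proof.
elim: p x => [|y p IH] x //; rewrite in_cons => /orP[/eqP -> /=|/IH[]].
  by rewrite !mem_head.
by rewrite !(in_cons _ p) => e1 e2; rewrite !in_cons in e1 *; rewrite e1 e2 !orbT.
Qed.

Lemma uadj_side e x y : uadj E x y -> (x, y) != e -> (y, x) != e ->
  (x \in tail_side e) = (y \in tail_side e).
Proof.
move=> /orP[] xyE xy yx; first exact: (tail_side_edge xyE xy).
exact/esym/(tail_side_edge xyE yx).
Qed.

Lemma path_avoids e x p : path (uadj E) x p -> e.1 \notin x :: p ->
  (x \in tail_side e) = (last x p \in tail_side e).
Proof.
elim: p x => [|y p IH] x //= /andP[xy py] e1.
rewrite -IH //; last by apply: contra e1 => e1; rewrite in_cons e1 orbT.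
apply: uadj_side => //; apply: contraNneq e1 => <- /=; by rewrite !inE eqxx ?orbT.
Qed.

(** A simple path visits each end of [e] once, so it uses [e] only in this one step and changes side
    nowhere else. *)
Lemma path_crosses e x p : e \in E -> path (uadj E) x p -> uniq (x :: p) ->
  e \in zip (x :: p) p -> (x \in tail_side e) && (last x p \notin tail_side e).
Proof.
move=> eE; elim: p x => [|y p IH] x // /andP[xy py] /andP[xyp yp].
rewrite -[zip _ _]/((x, y) :: zip (y :: p) p) in_cons => /orP[/eqP exy|ep].
  have x1 : e.1 = x by rewrite exy.
  have y2 : e.2 = y by rewrite exy.
  rewrite -x1 tail_in_side /= -(@path_avoids e) ?x1 //.
  by rewrite -y2 head_notin_side.
have /andP[ys ->] := IH y py yp ep; rewrite andbT.
have [e1 e2] := mem_path_edges ep.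
rewrite (uadj_side xy) //; apply: contraNneq xyp => exy.
  by move: e1; rewrite -exy.
by rewrite in_cons; move: e2; rewrite -exy /= => ->; rewrite orbT.
Qed.

Lemma crossing_path e x p : path (uadj E) x p -> x \in tail_side e ->
  last x p \notin tail_side e -> e \in zip (x :: p) p.
Proof.
elim: p x => [|y p IH] x /=; first by move=> _ ->.
move=> /andP[xy py] xe le; rewrite in_cons.
have [ye|ye] := boolP (y \in tail_side e); first by rewrite (IH y) ?orbT.
have [-> //|ne] := eqVneq e (x, y).
have := ye; rewrite -(uadj_side xy) ?xe // 1?eq_sym //.
by apply: contraNneq ye => ->; apply: (tail_in_side (y, x)).
Qed.

Lemma traversesP i u v :
  traverses E u v (val i) <-> (u \in edge_side i) && (v \notin edge_side i).
Proof.
case: i => e eE; rewrite /edge_side /=; split=> [[[x p] [[/= pP pU] <- <-]]|/andP[ue ve]].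
  exact: path_crosses.
have /connectP[p0 p0P] := tree_connect u v; case/shortenP: p0P => p pP pU _ v_last.
exists (u, p); split=> //=; apply: crossing_path => //=; by rewrite -v_last.
Qed.

(** A node of [A] lying in as many of the halves as possible lies in all of them: the near end of a
    missed half would gain that half and, by [half_gate], lose none. *)
Lemma subtree_helly (A : {set T}) (b : tree_edge -> bool) :
  (forall i, A :&: half (i, b i) != set0) ->
  (forall i j, half (i, b i) :&: half (j, b j) != set0) ->
  A != set0 ->
  (forall P, A :&: half P != set0 -> A :&: half (opp P) != set0 -> near_end P \in A) ->
  exists2 t, t \in A & forall i, t \in half (i, b i).
Proof.
move=> Ab bb /finset.set0Pn[t0 t0A] Anear.
pose n t := #|[set i | t \in half (i, b i)]|.
have [t + maxt] := arg_maxnP n t0A; rewrite [X in is_true X](_ : _ = (t \in A)) // => tA.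
exists t => // i; apply/negPn/negP => ti.
have niA : near_end (i, b i) \in A.
  by apply: Anear => //; apply/finset.set0Pn; exists t; rewrite !inE tA side_opp inE.
suff: n t < n (near_end (i, b i)) by rewrite ltnNge => /negP; apply; apply: maxt.
apply: proper_card; apply/properP; split.
  apply/fintype.subsetP => j; rewrite !inE => tj.
  exact: half_gate tj ti (bb i j).
by exists i; rewrite !inE ?near_end_in.
Qed.

End Tree.

(** * Optimal location *)

Section Location.
Local Open Scope nat_scope.
Local Open Scope set_scope.

Variables (V T : finType) (E : {set T * T}) (F : V -> {set T}).
Variable D : seq (V * V).

Local Notation L := (@edge_side T E).
Local Notation half := (side L).

Hypothesis treeE : oriented_tree E.
Hypothesis F_neq0 : forall x, F x != set0.
Hypothesis F_near : forall x P, ~~ (F x \subset half P) ->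
  ~~ (F x \subset half (opp P)) -> near_end P \in F x.
Hypothesis balF : forall x P Q, P.2 != Q.2 -> half P \subset half Q ->
  [|| balanced D x, F x \subset half (opp P) | F x \subset half Q].

Lemma tight_exists P : exists X, tight L F D P X.
Proof.
have f0 : feasible L F P [set x | F x \subset half P].
  apply/feasibleP => x; rewrite !inE; split=> // FoP; apply/negP => FP.
  have := F_neq0 x; have: F x \subset half P :&: half (opp P) by rewrite subsetI FP.
  by rewrite side_opp setICr finset.subset0 => ->.
have [X fX minX] := arg_minnP (dcut P.2 D) f0.
exists X; apply/andP; split=> //; apply/forallP => Y; apply/implyP; exact: minX.
Qed.

(** Uncrossing makes [X :&: Y] tight for [P], so a smallest tight set [X] lies inside each such
    [Y]. *)
Lemma min_tight P : exists2 X, tight L F D P X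
  & forall Q Y, half P \subset half Q -> tight L F D Q Y -> X \subset Y.
Proof.
have [X0 tX0] := tight_exists P.
have [X tX minX] := arg_minnP (fun X : {set V} => #|X|) tX0.
exists X => // Q Y PQ tY; have [tI _ _] := uncross balF PQ tX tY.
suff <- : X :&: Y = X by rewrite finset.subsetIr.
by apply/eqP; rewrite eqEcard finset.subsetIl minX.
Qed.

(* Rooting the tree at [r] and taking, for every edge, the least tight set of
   the half away from [r] yields tight sets as laminar as the halves. *)
Lemma optimal_location : exists2 rho : V -> T, forall x, rho x \in F x
  & forall i, tight L F D (i, false) [set x | rho x \in L i].
Proof.
have [r _] : exists r, r \in [set: T] by case: treeE => /finset.set0Pn.
pose away (i : tree_edge E) := (i, r \in L i).
have r_away i : r \notin half (away i).
  by rewrite /side /=; case: ifP => ri; rewrite ?in_setC ri.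
have ex i : exists X, tight L F D (away i) X &&
    [forall R : (tree_edge E * bool) * {set V},
       (half (away i) \subset half R.1) && tight L F D R.1 R.2 ==> (X \subset R.2)].
  have [X tX minX] := min_tight (away i); exists X; rewrite tX /=.
  by apply/forallP => -[Q Y]; apply/implyP => /andP[]; apply: minX.
pose X i := xchoose (ex i).
have tX i : tight L F D (away i) (X i) by case/andP: (xchooseP (ex i)).
have minX i Q Y : half (away i) \subset half Q -> tight L F D Q Y -> X i \subset Y.
  move=> iQ tY; case/andP: (xchooseP (ex i)) => _ /forallP/(_ (Q, Y)).
  by rewrite iQ tY.
(* This bit selects the half away from [r] if [x] is in [X i], and the half containing [r]
   otherwise. *)
pose b x i := (x \in X i) (+) (r \notin L i).
have halfE x i : half (i, b x i) = if x \in X i then half (away i) else half (opp (away i)).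
  by rewrite /b /away /opp /side /=; case: (x \in X i); case: (r \in L i).
have meet P Q : ~~ (half P \subset half (opp Q)) -> half P :&: half Q != set0.
  by rewrite side_opp -finset.disjoints_subset -setI_eq0.
have ex_rho x : exists t, (t \in F x) && [forall i, t \in half (i, b x i)].
  have [t tF tb] : exists2 t, t \in F x & forall i, t \in half (i, b x i).
    apply: subtree_helly => // [i|i j|P].
    - rewrite halfE; have fX := feasibleP _ _ _ _ (tight_feasible (tX i)) x.
      have [xi|xi] := boolP (x \in X i); rewrite setI_eq0 disjoints_subset -side_opp.
        by apply: contraL xi; apply: (proj2 fX).
      by rewrite oppK; apply: contra xi; apply: (proj1 fX).
    - rewrite !halfE; have [xi|xi] := boolP (x \in X i);
        have [xj|xj] := boolP (x \in X j).
      (* Disjoint halves would force [X i] into the complement of [X j], by minimality of [X i],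
         although [x] is in both. *)
      + apply: meet; apply: contraL xj => ij.
        have := minX _ _ _ ij (tightC (tX j)).
        by move/fintype.subsetP/(_ x xi); rewrite inE.
      + apply: meet; rewrite oppK; apply: contra xj => ij.
        by have /fintype.subsetP := minX _ _ _ ij (tX j); apply.
      + rewrite finset.setIC; apply: meet; rewrite oppK; apply: contra xi => ji.
        by have /fintype.subsetP := minX _ _ _ ji (tX i); apply.
      + by apply/finset.set0Pn; exists r; rewrite !side_opp !inE !r_away.
    - rewrite !setI_eq0 !disjoints_subset -!side_opp oppK => h1 h2.
      exact: F_near.
  by exists t; rewrite tF; apply/forallP.
exists (fun x => xchoose (ex_rho x)) => [x|i].
  by case/andP: (xchooseP (ex_rho x)).
have rhoi x : xchoose (ex_rho x) \in half (i, b x i).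
  by case/andP: (xchooseP (ex_rho x)) => _ /forallP.
have := tX i; rewrite /away; have [ri|ri] := boolP (r \in L i) => ti.
  suff -> : [set x | xchoose (ex_rho x) \in L i] = ~: X i by have := tightC ti.
  apply/setP => x; rewrite in_setC in_set; have := rhoi x; rewrite /b /side /= ri addbF.
  by case: (x \in X i) => //=; rewrite in_setC => /negbTE.
suff -> : [set x | xchoose (ex_rho x) \in L i] = X i by [].
apply/setP => x; rewrite in_set; have := rhoi x; rewrite /b /side /= ri addbT.
by case: (x \in X i) => //=; rewrite in_setC => /negbTE.
Qed.

End Location.

(** * Networks and multiflows *)

(* Only now, since [classical_sets] hides lemmas of [finset]. *)
From mathcomp Require Import boolp classical_sets reals.

Section Network.
Local Open Scope nat_scope.

Variables (V : finType) (EG : {set V * V}) (c : V * V -> nat).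

(** Capacities become multiplicities: walks that together use exactly this list respect all
    capacities. *)
Definition arcs : seq (V * V) := flatten [seq nseq (c e) e | e <- enum EG].

Definition arc_walks : seq (V * seq V) := [seq (a.1, [:: a.2]) | a <- arcs].

Lemma count_arcs p : count p arcs = \sum_(e in EG | p e) c e.
Proof.
rewrite count_flatten -map_comp sumnE big_map big_enum [RHS]big_mkcondr /=.
by apply: eq_bigr => e _; rewrite count_nseq; case: (p e); rewrite ?mul1n.
Qed.

Lemma count_mem_arcs e : count_mem e arcs <= c e.
Proof.
rewrite count_arcs; have [eE|eE] := boolP (e \in EG).
  by rewrite (big_pred1 e) // => f /=; case: eqP => [->|_]; rewrite ?eE ?andbF.
by rewrite big1 // => f /andP[fE /eqP fe]; rewrite -fe fE in eE.
Qed.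

Lemma dcut_arcs X : dcut false arcs X = cut_capacity EG c X.
Proof. by rewrite /dcut count_arcs. Qed.

Lemma balanced_arcs x : eulerian_at EG c x -> balanced arcs x.
Proof. by rewrite /balanced !count_arcs => /eqP. Qed.

Lemma walk_ends_arcs : walk_ends arc_walks = arcs.
Proof.
rewrite /walk_ends -map_comp -[RHS]map_id; apply: eq_map => -[x y] //.
Qed.

Lemma walk_edges_arcs : walk_edges arc_walks = arcs.
Proof.
rewrite /walk_edges /arc_walks; elim: arcs => //= -[x y] s ->.
by [].
Qed.

Lemma mem_arcs e : e \in arcs -> e \in EG.
Proof.
case/flattenP => s /mapP[f]; rewrite mem_enum => fE -> /nseqP[-> _] //.
Qed.

Definition shorten_walk (w : V * seq V) : V * seq V := (w.1, shorten w.1 w.2).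

(** A walk is a path of the relation formed by its own edges, and shortening within that relation
    introduces no other edge. *)
Lemma shorten_walkP w :
  [/\ path_end (shorten_walk w) = path_end w, uniq (path_nodes (shorten_walk w))
    & {subset path_edges (shorten_walk w) <= path_edges w}].
Proof.
case: w => x s; pose e : rel V := [rel u v | (u, v) \in path_edges (x, s)].
have pathP (r : seq (V * V)) y p : {subset zip (y :: p) p <= r} ->
    path [rel u v | (u, v) \in r] y p.
  elim: p y => [|z p IH] y //= yp; rewrite yp ?mem_head //=; apply: IH => f fp.
  by apply: yp; rewrite in_cons fp orbT.
have Ppath (r : seq (V * V)) y p : path [rel u v | (u, v) \in r] y p ->
    {subset zip (y :: p) p <= r}.
  elim: p y => [|z p IH] y //= /andP[yz /IH zp] f.
  by rewrite in_cons => /orP[/eqP ->|/zp].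
rewrite /shorten_walk /path_end /path_nodes /path_edges /=.
have := pathP _ x s (fun f fs => fs); case/shortenP => p pP pU _.
by split=> //; apply: Ppath.
Qed.

Lemma path_cross_cut (X : {set V}) x s : x \in X -> last x s \notin X ->
  has (leaves false X) (zip (x :: s) s).
Proof.
elim: s x => [|y s IH] x /= xX; first by rewrite xX.
rewrite /leaves /tip /= xX /=.
by case: (boolP (y \in X)) => //= yX; apply: IH.
Qed.

Lemma path_edges_sub (P : V * seq V) : is_dipath EG P -> {subset path_edges P <= EG}.
Proof.
case: P => x p [+ _]; rewrite /path_edges /=.
elim: p x => [|y p IH] x //= /andP[xy /IH py] e.
by rewrite in_cons => /orP[/eqP ->|/py].
Qed.

Lemma sub_path_edges (w : V * seq V) : {subset path_edges w <= EG} ->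
  path [rel x y | (x, y) \in EG] w.1 w.2.
Proof.
case: w => x s; rewrite /path_edges /=.
elim: s x => [|y s IH] x //= xs; rewrite xs ?mem_head //=; apply: IH => f fs.
by apply: xs; rewrite in_cons fs orbT.
Qed.

End Network.

(** * Directed paths and opposed tree edges *)

Section TerminalTrees.
Variables (T : finType) (E : {set T * T}).
Hypothesis treeE : oriented_tree E.
Local Notation L := (@edge_side T E).
Local Notation half := (side L).

(** A step along an oriented edge keeps the side of [i] or leaves [L i], so the nodes in [L i] form
    an initial part of the path. *)
Lemma dipath_prefix i x p : {subset zip (x :: p) p <= E} ->
  forall v, v \in x :: p -> (v \in L i -> x \in L i) /\ (last x p \in L i -> v \in L i).
Proof.
elim: p x => [|y p IH] x /= pE v; first by rewrite inE => /eqP ->.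
have yx : y \in L i -> x \in L i.
  have xyE : (x, y) \in E by apply: pE; rewrite mem_head.
  have [xy yi|xy] := eqVneq (x, y) (val i); last by have /= <- := tail_side_edge xyE xy.
  by have := head_notin_side treeE (valP i); rewrite -xy /= /L xy yi.
have pE' : {subset zip (y :: p) p <= E} by move=> f fp; apply: pE; rewrite in_cons fp orbT.
rewrite in_cons => /orP[/eqP ->|/(IH y pE')[h1 h2]]; split=> //.
  move=> li; apply: yx; by have [_ ->] := IH y pE' y (mem_head _ _).
by move=> /h1/yx.
Qed.

(** This replaces balance at terminals that need not be Eulerian. The side of one end decides: the
    last node if [P] is a head side, the first if it is a tail side. *)
Lemma path_subtree_side (F : subgraph T) P Q : is_subtree E F ->
  single_node F \/ directed_path F -> P.2 != Q.2 -> half P \subset half Q ->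
  (nodes F \subset half (opp P)) || (nodes F \subset half Q).
Proof.
move=> [[/fintype.subsetP FE _] _] [[u ->]|[[x p] [_ nF eF]]] PQ2 PQ.
  rewrite !finset.sub1set side_opp finset.in_setC; have [uP|//] := boolP (u \in half P).
  by rewrite (fintype.subsetP PQ).
have pE : {subset zip (x :: p) p <= E} by move=> f fp; apply: FE; rewrite eF.
have pre i := dipath_prefix i pE.
have subH R : (forall v, v \in x :: p -> v \in half R) -> nodes F \subset half R.
  by move=> h; apply/fintype.subsetP => v; rewrite nF => /h.
case: P Q PQ2 PQ => [i []] [j []] //= _ PQ; move/fintype.subsetP: PQ.
  move=> PQ; have [li|li] := boolP (last x p \in L i).
    apply/orP; left; apply: subH => v /(pre i)[_ /(_ li)].
    by rewrite /side.
  apply/orP; right; apply: subH => v /(pre j)[_]; apply.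
  by apply: PQ; rewrite /side /= finset.in_setC.
move=> PQ; have [xi|xi] := boolP (x \in L i).
  apply/orP; right; apply: subH => v /(pre j)[vx _].
  have := PQ _ xi; rewrite /side /= !finset.in_setC; exact: contra vx.
apply/orP; left; apply: subH => v /(pre i)[vx _].
rewrite /side /= finset.in_setC; exact: contra vx xi.
Qed.

End TerminalTrees.

(** * Tree distances as sums over tree cuts *)

Section TreeSums.
Variables (R : realType) (T : finType) (E : {set T * T}) (alpha : T * T -> R).
Hypothesis treeE : oriented_tree E.

Lemma tree_distE u v : tree_dist E alpha u v =
  \sum_(e in E | (u \in tail_side E e) && (v \notin tail_side E e)) alpha e.
Proof.
apply: eq_bigl => e; case: (boolP (e \in E)) => //= eE.
have uvP := traversesP treeE (Sub e eE) u v.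
by apply/asboolP/idP => [/uvP|h]; last exact/uvP.
Qed.

Lemma exchange_weights (J : Type) (r : seq J) (p : pred J) (w : J -> R)
    (K : J -> pred (T * T)) :
  \sum_(j <- r | p j) w j * \sum_(e in E | K j e) alpha e =
  \sum_(e in E) alpha e * \sum_(j <- r | p j && K j e) w j.
Proof.
under eq_bigr do rewrite mulr_sumr big_mkcondr.
rewrite exchange_big; apply: eq_bigr => e _; rewrite mulr_sumr [RHS]big_mkcondr.
by apply: eq_bigr => j _; case: ifP => // _; rewrite mulrC.
Qed.

(** Reduces both location costs and flow values to one cut problem per tree edge. *)
Lemma sum_tree_dist (J : Type) (r : seq J) (p : pred J) (w : J -> R)
    (s t : J -> T) :
  \sum_(j <- r | p j) w j * tree_dist E alpha (s j) (t j) =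
  \sum_(e in E) alpha e * \sum_(j <- r | p j &&
     ((s j \in tail_side E e) && (t j \notin tail_side E e))) w j.
Proof. by rewrite -exchange_weights; apply: eq_bigr => j _; rewrite tree_distE. Qed.

End TreeSums.

(** * Multiflows bounded by cuts and built from walks *)

Section Flows.
Variables (R : realType) (V : finType) (EG : {set V * V}) (S : {set V}).
Variable c : V * V -> nat.

(** Each path counted uses an edge leaving [X], to whose capacity its weight is charged. *)
Lemma multiflow_le_cut Ps (lam : V * seq V -> R) (X : {set V}) :
  is_multiflow EG S c Ps lam ->
  \sum_(P <- Ps | (path_start P \in X) && (path_end P \notin X)) lam P
    <= (cut_capacity EG c X)%:R.
Proof.
move=> flow; have lam0 := mf_ge0 flow.
rewrite /cut_capacity natr_sum.
pose cutE e := (e \in EG) && ((e.1 \in X) && (e.2 \notin X)).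
apply: (@le_trans _ _ (\sum_(e | cutE e) \sum_(P <- Ps | e \in path_edges P) lam P)); last first.
  by apply: ler_sum => e /andP[eE _]; exact: (mf_capacity flow eE).
rewrite (exchange_big_dep xpredT) //= big_mkcond /= big_seq [leRHS]big_seq.
apply: ler_sum => P PPs; case: ifP => [/andP[sX tX]|_]; last first.
  by apply: sumr_ge0 => e _; apply: lam0.
have /hasP[e eP eX] := path_cross_cut sX tX.
have eE := path_edges_sub (mf_dipath flow PPs) eP.
rewrite (bigD1 e) /=; last by rewrite /cutE eE eP andbT; exact: eX.
by rewrite lerDl sumr_ge0 // => f _; apply: lam0.
Qed.

Lemma sum_count_undup (T : eqType) (s : seq T) (p : pred T) (f : T -> R) :
  \sum_(x <- undup s | p x) (count_mem x s)%:R * f x = \sum_(x <- s | p x) f x.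
Proof.
rewrite -[RHS]big_undup_iterop_count; apply: eq_bigr => x _.
by rewrite mulr_natl.
Qed.

(** Walks between distinct terminals are shortened to paths, weighted by multiplicity. Shortening
    keeps the ends, hence the value, and uses no edge more often. *)
Lemma multiflow_of_walks (ws : seq (V * seq V)) :
  {subset walk_edges ws <= EG} ->
  (forall e, (count_mem e (walk_edges ws) <= c e)%N) ->
  exists Ps (lam : V * seq V -> R), is_integral_multiflow EG S c Ps lam
    /\ forall mu : V -> V -> R, mf_value mu Ps lam =
       \sum_(a <- walk_ends ws | [&& a.1 \in S, a.2 \in S & a.1 != a.2]) mu a.1 a.2.
Proof.
move=> wsE wsc.
pose good (w : V * seq V) :=
  [&& path_start w \in S, path_end w \in S & path_start w != path_end w].
pose qs := [seq shorten_walk w | w <- ws & good w].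
exists (undup qs), (fun P => (count_mem P qs)%:R); split; last first.
  move=> mu; rewrite /mf_value sum_count_undup big_map big_filter /walk_ends big_map.
  by apply: eq_bigr => w _; case: (shorten_walkP w) => ->.
have qsP P : P \in undup qs -> exists2 w, w \in ws & good w /\ P = shorten_walk w.
  by rewrite mem_undup => /mapP[w]; rewrite mem_filter => /andP[gw wws] ->; exists w.
split; last by move=> P _; apply: natr_int.
split; first exact: undup_uniq.
- move=> P /qsP[w wws [_ ->]]; have [_ uw sw] := shorten_walkP w.
  split=> //; apply: sub_path_edges => e /sw ew; apply: wsE.
  by apply/flattenP; exists (path_edges w) => //; apply: map_f.
- move=> P /qsP[w wws [/and3P[h1 h2 h3] ->]].
  by have [-> _ _] := shorten_walkP w.
- by move=> P _; apply: ler0n.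
move=> e eE; under eq_bigr do rewrite -[_%:R]mulr1.
rewrite sum_count_undup -[1]/(1%:R) -natr_sum ler_nat sum1_count.
apply: leq_trans (wsc e); rewrite /walk_edges /qs; elim: (ws) => //= w ws' IH.
rewrite count_cat; case: (good w) => /=; last by apply: leq_trans IH _; rewrite leq_addl.
apply: leq_add => //; have [_ _ sw] := shorten_walkP w.
case: (boolP (e \in _)) => // /sw; by rewrite -has_pred1 has_count.
Qed.

End Flows.

(** * Admissible locations and the partial cuts *)

Section TerminalSets.
Variables (R : realType) (VG : finType) (EG : {set VG * VG}) (S : {set VG}).
Variables (c : VG * VG -> nat) (mu : VG -> VG -> R).
Variables (VT : finType) (ET : {set VT * VT}) (alpha : VT * VT -> R).
Variable F : VG -> subgraph VT.
Hypothesis mu_real : tree_realization S mu ET alpha F.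

(** The whole tree lies in no half, so nonterminals put no constraint on feasible sets. *)
Definition location_set x : {set VT} :=
  if x \in S then nodes (F x) else [set: VT]%SET.

Local Notation L := (@edge_side VT ET).

Lemma location_set_neq0 x : location_set x != finset.set0.
Proof.
rewrite /location_set; case: ifP => [/(tr_subtree mu_real)[_ []] //|_].
by case: (tr_tree mu_real).
Qed.

Lemma location_set_near x P : ~~ (location_set x \subset side L P) ->
  ~~ (location_set x \subset side L (opp P)) -> near_end P \in location_set x.
Proof.
rewrite /location_set; case: ifP => [xS|_ _ _]; last by rewrite finset.in_setT.
move=> xP xoP.
by have [] := subtree_crosses (tr_subtree mu_real xS) xP xoP.
Qed.

Lemma location_set_half x P : location_set x \subset side L P -> x \in S.
Proof.
rewrite /location_set; case: ifP => // _ /fintype.subsetP/(_ (far_end P)).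
by rewrite finset.in_setT (negbTE (far_end_notin (tr_tree mu_real) P)) => /(_ isT).
Qed.

Lemma location_set_halves x y P : location_set x \subset side L P ->
  location_set y \subset side L (opp P) -> [&& x \in S, y \in S & x != y].
Proof.
move=> xP yP; rewrite (location_set_half xP) (location_set_half yP) /=.
apply: contraTneq (location_set_neq0 x) => xy; rewrite negbK -finset.subset0.
apply: fintype.subset_trans (_ : side L P :&: side L (opp P) \subset _)%SET.
  by rewrite finset.subsetI xP xy.
by rewrite side_opp finset.setICr.
Qed.

Lemma mem_cut_tail i x :
  (x \in cut_tail S ET F (val i)) = (location_set x \subset side L (i, false)).
Proof.
rewrite /cut_tail finset.in_set; apply/andP/idP => [[xS]|xi].
  by rewrite /location_set xS.
by have xS := location_set_half xi; move: xi; rewrite /location_set xS.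
Qed.

Lemma mem_cut_head i x :
  (x \in cut_head S ET F (val i)) = (location_set x \subset side L (i, true)).
Proof.
rewrite /cut_head finset.in_set component_head ?(valP i) //; last exact: tr_tree mu_real.
apply/andP/idP => [[xS]|xi]; first by rewrite /location_set xS.
by have xS := location_set_half xi; move: xi; rewrite /location_set xS.
Qed.

Lemma feasible_cutE i Y : feasible L location_set (i, false) Y =
  (cut_tail S ET F (val i) \subset Y) && (Y \subset ~: cut_head S ET F (val i))%SET.
Proof.
apply/feasibleP/andP => [fY|[/fintype.subsetP tY /fintype.subsetP Yh] x].
  split; apply/fintype.subsetP => x; first by rewrite mem_cut_tail => /(proj1 (fY x)).
  by rewrite finset.in_setC mem_cut_head; apply: contraL => /(proj2 (fY x)).
split; first by rewrite -mem_cut_tail => /tY.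
rewrite -[opp _]/(i, true) -mem_cut_head; apply: contraL => /Yh.
by rewrite finset.in_setC.
Qed.

Lemma min_cut_tight i X : tight L location_set (arcs EG c) (i, false) X ->
  min_cut EG c (cut_tail S ET F (val i)) (cut_head S ET F (val i)) =
  cut_capacity EG c X.
Proof.
move=> tX; have fX := tight_feasible tX; have := fX; rewrite feasible_cutE => /andP[tX' Xh].
rewrite /min_cut; case: arg_minnP => [|Y]; first by rewrite subxx (fintype.subset_trans tX').
rewrite -feasible_cutE => fY minY; apply/eqP; rewrite eqn_leq minY -?feasible_cutE //.
by rewrite -!dcut_arcs; apply: tight_le tX fY.
Qed.

End TerminalSets.

(** * The min-max equality *)

Theorem theorem3p2 (R : realType)
    (VG : finType) (EG : {set VG * VG}) (S : {set VG}) (c : VG * VG -> nat)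
    (mu : VG -> VG -> R)
    (VT : finType) (ET : {set VT * VT}) (alpha : VT * VT -> R)
    (F : VG -> subgraph VT)
    (mu_dist : directed_distance S mu)
    (mu_real : tree_realization S mu ET alpha F)
    (inner : inner_eulerian EG S c)
    (term : forall s, s \in S ->
       ~ (single_node (F s) \/ directed_path (F s)) -> eulerian_at EG c s) :
  exists m : R,
    [/\ is_max (mfp_values mu EG S c) m,
        is_max (imfp_values mu EG S c) m,
        is_min (location_costs EG S c ET alpha F) m
      & m = \sum_(e in ET)
              alpha e * (min_cut EG c (cut_tail S ET F e) (cut_head S ET F e))%:R].
Proof.
have tree := tr_tree mu_real.
pose L := @edge_side VT ET; pose Fx := location_set S F; pose D := arcs EG c.
have balF x P Q : P.2 != Q.2 -> side L P \subset side L Q ->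
    [|| balanced D x, Fx x \subset side L (opp P) | Fx x \subset side L Q].
  move=> PQ2 PQ; have [xS|xS] := boolP (x \in S); last by rewrite balanced_arcs //; apply: inner.
  have [h|h] := pselect (single_node (F x) \/ directed_path (F x)).
    rewrite /Fx /location_set xS.
    by rewrite (path_subtree_side tree (tr_subtree mu_real xS) h PQ2 PQ) orbT.
  by rewrite balanced_arcs //; apply: term h.
have [rho rhoF tight_rho] :=
  optimal_location tree (location_set_neq0 mu_real) (location_set_near mu_real) balF.
pose X e := [set x | rho x \in tail_side ET e]%SET.
have min_cutE e : e \in ET ->
    min_cut EG c (cut_tail S ET F e) (cut_head S ET F e) = cut_capacity EG c (X e).
  by move=> eE; apply: (min_cut_tight mu_real (tight_rho (Sub e eE))).
have rhoS : {in S, forall s, rho s \in nodes (F s)}.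
  by move=> s sS; have := rhoF s; rewrite /location_set sS.
have cost (rho' : VG -> VT) :
    \sum_(a in EG) (c a)%:R * tree_dist ET alpha (rho' a.1) (rho' a.2) =
    \sum_(e in ET) alpha e
      * (cut_capacity EG c [set x | rho' x \in tail_side ET e]%SET)%:R.
  rewrite sum_tree_dist //; apply: eq_bigr => e _; congr (_ * _).
  rewrite /cut_capacity natr_sum; apply: eq_bigl => a.
  by rewrite !finset.in_set.
set m := \sum_(e in ET) alpha e * _; exists m.
have mE : m = \sum_(e in ET) alpha e * (cut_capacity EG c (X e))%:R.
  by apply: eq_bigr => e eE; rewrite min_cutE.
(* Weak duality: [mu] is at most the distance between the optimal locations, and the flow across
   each tree edge is at most the induced cut. *)
have flow_le Ps lam : is_multiflow EG S c Ps lam -> mf_value mu Ps lam <= m.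
  move=> flow; apply: (@le_trans _ _ (\sum_(P <- Ps) lam P
      * tree_dist ET alpha (rho (path_start P)) (rho (path_end P)))).
    rewrite /mf_value big_seq [leRHS]big_seq; apply: ler_sum => P PPs.
    have [sS tS _] := mf_terminals flow PPs.
    apply: ler_wpM2l; first exact: (mf_ge0 flow PPs).
    have [_] := tr_dist mu_real sS tS; apply.
    by exists (rho (path_start P)), (rho (path_end P)); split=> //; apply: rhoS.
  rewrite sum_tree_dist // mE; apply: ler_sum => e eE.
  apply: ler_wpM2l; first exact: (tr_ge0 mu_real eE).
  apply: le_trans (multiflow_le_cut (X e) flow); rewrite le_eqVlt; apply/predU1P; left.
  by apply: eq_bigl => P; rewrite !finset.in_set.
have [ws ws_edges ws_lock] : exists2 ws, perm_eq (walk_edges ws) D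
    & forall i, (dcut false D (X (val i))
       <= count (fun a => (Fx a.1 \subset L i) && (Fx a.2 \subset ~: L i)%SET)
            (walk_ends ws))%N.
  have [||ws] := @walk_locking _ _ _ L Fx (half_neq0 tree) (half_cross_free tree)
    (fun i => X (val i)) (arc_walks EG c); rewrite ?walk_ends_arcs ?walk_edges_arcs //.
  by exists ws.
have [e|e|Ps [lam [flow value]]] := @multiflow_of_walks R _ EG S c ws.
- by rewrite (perm_mem ws_edges) => /mem_arcs.
- by rewrite (permP ws_edges); apply: count_mem_arcs.
have m_le : m <= mf_value mu Ps lam.
  rewrite value mE.
  (* The weight 1 fits [exchange_weights]; after the exchange, locking bounds the number of walks
     from below by the minimum cut of each tree edge. *)
  apply: (@le_trans _ _ (\sum_(a <- walk_ends ws |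
     [&& a.1 \in S, a.2 \in S & a.1 != a.2]) 1 * \sum_(e in ET |
       (a.1 \in cut_tail S ET F e) && (a.2 \in cut_head S ET F e)) alpha e)).
    rewrite exchange_weights; apply: ler_sum => e eE.
    apply: ler_wpM2l; first exact: (tr_ge0 mu_real eE).
    rewrite -[1]/(1%:R) -natr_sum ler_nat sum1_count -dcut_arcs.
    apply: leq_trans (ws_lock (Sub e eE)) _; apply: sub_count => a /andP[a1 a2] /=.
    have := mem_cut_tail mu_real (Sub e eE) a.1; have := mem_cut_head mu_real (Sub e eE) a.2.
    rewrite /= => -> ->; rewrite a1 a2 !andbT.
    exact: (@location_set_halves _ _ _ _ _ _ _ _ mu_real _ _ (Sub e eE, false)).
  apply: ler_sum => a /and3P[sS tS _]; rewrite mul1r.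
  (* Wherever the distance is attained, every tree edge with the two terminals in its two cut parts
     is traversed. *)
  have [[u [v [uF vF ->]]] _] := tr_dist mu_real sS tS.
  rewrite tree_distE // big_mkcondr [leRHS]big_mkcondr; apply: ler_sum => e eE.
  case: ifP => [/andP[sA tB]|_]; last by case: ifP => // _; exact: (tr_ge0 mu_real eE).
  suff -> : (u \in tail_side ET e) && (v \notin tail_side ET e) by [].
  move: sA tB; rewrite /cut_tail /cut_head 2!finset.in_set component_head // => /andP[_].
  move=> /fintype.subsetP/(_ u uF) ue /andP[_ /fintype.subsetP/(_ v vF)].
  by rewrite finset.in_setC => ve; apply/andP.
have valueE : m = mf_value mu Ps lam.
  by apply/le_anti; rewrite m_le flow_le //; case: flow.
split=> //.
- split; first by exists Ps, lam; split=> //; case: flow.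
  by move=> z [Ps' [lam' [flow' ->]]]; apply: flow_le.
- split; first by exists Ps, lam.
  by move=> z [Ps' [lam' [[flow' _] ->]]]; apply: flow_le.
split; first by exists rho; rewrite ?cost.
move=> z [rho' rho'S ->]; rewrite cost /m; apply: ler_sum => e eE.
apply: ler_wpM2l; first exact: (tr_ge0 mu_real eE).
rewrite ler_nat min_cutE // -!dcut_arcs.
(* Any admissible location induces a feasible set for every tree edge. *)
apply: (tight_le (tight_rho (Sub e eE))); apply/feasibleP => x.
rewrite finset.in_set.
have rho'F : rho' x \in Fx x.
  by rewrite /Fx /location_set; case: ifP => [/rho'S //|_]; rewrite finset.in_setT.
split=> /fintype.subsetP/(_ _ rho'F) //.
by rewrite side_opp finset.in_setC.
Qed.
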